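(* The critical exponent of the Riesz projection $P_1^+$ on the circle $\mathbb{T}$ is $4$; that is, $$p_1=\sup\left\{p\ge 2:\ \|P_1^+\|_{\infty,p}=1\right\}=4.$$
   Context: Let $\mathbb{T}=\{\zeta\in\mathbb{C}:|\zeta|=1\}$ with Lebesgue measure $\sigma_1$ normalized so that $\sigma_1(\mathbb{T})=1$; $L^p(\mathbb{T})$ denotes the space of complex-valued functions with norm $\|f\|_p$ computed with respect to $\sigma_1$. For $f\in L^2(\mathbb{T})$ with Fourier series $f(\zeta)=\sum_{k\in\mathbb{Z}}\hat f(k)\zeta^k$, the Riesz projection is $P_1^+f(\zeta)=\sum_{k\ge 0}\hat f(k)\zeta^k$ (the sum includes $k=0$). For $2\le p<\infty$, $\|P_1^+\|_{\infty,p}$ denotes the norm of the operator $P_1^+:L^\infty(\mathbb{T})\to L^p(\mathbb{T})$, i.e. $\|P_1^+\|_{\infty,p}=\sup\{\|P_1^+f\|_p: f\in L^\infty(\mathbb{T}),\ \|f\|_\infty\le 1\}$. *)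

(* Defs.v *)
From HB Require Import structures.
From mathcomp Require Import all_boot all_order all_algebra.
From mathcomp Require Import complex.
From mathcomp Require Import all_classical all_reals all_analysis.
From mathcomp Require Import measurable_realfun ess_sup_inf.

Set Implicit Arguments.
Unset Strict Implicit.
Unset Printing Implicit Defensive.

Import Order.TTheory GRing.Theory Num.Theory.
Import numFieldNormedType.Exports.

Local Open Scope classical_set_scope.
Local Open Scope ring_scope.
Local Open Scope complex_scope.

Record circle (R : realType) := Circle {
  circle_val :> R[i];
  circle_norm1 : `|circle_val| == 1 }.

HB.instance Definition _ (R : realType) := [isSub for @circle_val R].
HB.instance Definition _ (R : realType) := [Choice of circle R by <:].

Lemma circle1_subproof (R : realType) : `|1 : R[i]| == 1.
Proof. by rewrite normr1. Qed.

HB.instance Definition _ (R : realType) :=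
  isPointed.Build (circle R) (Circle (circle1_subproof R)).

Definition circle_coord (R : realType) (z : circle R) :
  measurableTypeR R * measurableTypeR R := (complex.Re z, complex.Im z).

(* The Borel sigma-algebra of the circle: the traces on the circle of the
   Borel subsets of the plane. *)
HB.instance Definition _ (R : realType) :=
  Measurable.copy (circle R) (g_sigma_algebra_preimageType (@circle_coord R)).

Lemma cis_subproof (R : realType) (t : R) : `|cos t +i* sin t| == 1.
Proof. by rewrite normc_def /= cos2Dsin2 sqrtr1. Qed.

Definition cis (R : realType) (t : measurableTypeR R) : circle R :=
  Circle (cis_subproof t).

Lemma measurable_cis (R : realType) : measurable_fun setT (@cis R).
Proof.
have mcoord : measurable_fun setT (@circle_coord R \o @cis R).
  apply: measurable_fun_pair => /=; apply: continuous_measurable_fun.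
    exact: continuous_cos.
  exact: continuous_sin.
by move=> _ _ [B mB <-]; rewrite setTI; exact: mcoord.
Qed.

HB.instance Definition _ (R : realType) :=
  isMeasurableFun.Build _ _ _ _ (@cis R) (@measurable_cis R).

Lemma twopi_gt0 (R : realType) : 0 < 2 * pi :> R.
Proof. by rewrite mulr_gt0// pi_gt0. Qed.

(* Normalized Lebesgue measure: the law of e^(it), t uniform on [0, 2 pi]. *)
Definition sigma1 (R : realType) : probability (circle R) R :=
  distribution (uniform_prob (twopi_gt0 R)) (@cis R).

Definition cmeasurable d (T : measurableType d) (R : realType) (f : T -> R[i]) :=
  measurable_fun setT (@complex.Re R \o f) /\ measurable_fun setT (@complex.Im R \o f).

Definition cLnorm d (T : measurableType d) (R : realType)
    (mu : {measure set T -> \bar R}) (p : \bar R) (f : T -> R[i]) : \bar R :=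
  'N[mu]_p [EFin \o @Normc.normc R \o f]%E.

Definition in_cLp d (T : measurableType d) (R : realType)
    (mu : {measure set T -> \bar R}) (p : \bar R) (f : T -> R[i]) :=
  cmeasurable f /\ (cLnorm mu p f < +oo)%E.

Definition cintegral d (T : measurableType d) (R : realType)
    (mu : {measure set T -> \bar R}) (f : T -> R[i]) : R[i] :=
  Rintegral mu setT (@complex.Re R \o f) +i* Rintegral mu setT (@complex.Im R \o f).

Definition fourier_coef (R : realType) (f : circle R -> R[i]) (k : int) : R[i] :=
  cintegral (sigma1 R) (fun z => f z * conjc ((z : R[i]) ^ k)).

Definition riesz_sum (R : realType) (f : circle R -> R[i]) (n : nat) :
    circle R -> R[i] :=
  fun z => \sum_(0 <= k < n) fourier_coef f k%:Z * (z : R[i]) ^+ k.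

(* A representative of the sum, in L^2, of the series of the nonnegative
   frequencies of f. For f in L^2 such a g exists and is unique almost
   everywhere, so the default 0 plays no role. *)
Definition riesz_proj (R : realType) (f : circle R -> R[i]) : circle R -> R[i] :=
  xget (fun=> 0) [set g | in_cLp (sigma1 R) 2%:E g /\
    cLnorm (sigma1 R) 2%:E (fun z => g z - riesz_sum f n z) @[n --> \oo]
      --> 0%E].

Definition riesz_norm (R : realType) (p : \bar R) : \bar R :=
  ereal_sup [set cLnorm (sigma1 R) p (riesz_proj f) |
    f in [set f | in_cLp (sigma1 R) +oo%E f /\
                  (cLnorm (sigma1 R) +oo%E f <= 1)%E]].

(* Main.v *)
(** For the upper bound at p = 4, split f = g + conj h with g analytic and h
    analytic vanishing at 0. If |f| <= 1 pointwise then
    |g|^4 <= 1 - 4 Re (g h) + 2 Re ((g h)^2), and the right-hand side integrates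
    to 1 because g h vanishes at 0. This is applied to the Fejer means of f,
    which are trigonometric polynomials bounded by 1; their analytic parts
    converge in L^2 to P f, being the Cesaro means of the partial sums.

    For p > 4, take f = c (1 - e^2 + e z - e conj z + e^2 conj z^2), for which
    |f|^2 <= c^2 (1 + 12 e^3) and P f = c (1 - e^2 + e z). With c chosen so that
    the first bound is 1, the fourth moment of |P f| is at least 1 - O(e^3)
    while |P f| has variance of order e^2, so a strict form of Jensen's
    inequality for x |-> x^(p/4) gives a p-norm above 1 for small e. *)

Require Import Defs.
From HB Require Import structures.
From mathcomp Require Import all_boot all_order all_algebra.
From mathcomp Require Import complex.
From mathcomp Require Import all_classical all_reals all_analysis.
From mathcomp Require Import measurable_realfun ess_sup_inf.
From mathcomp Require Import ring lra.

Set Implicit Arguments.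
Unset Strict Implicit.
Unset Printing Implicit Defensive.

Import Order.TTheory GRing.Theory Num.Theory.
Import numFieldNormedType.Exports.

Local Open Scope classical_set_scope.
Local Open Scope ring_scope.

(** * Complex numbers through their real and imaginary parts *)

Section complex_modulus.
Context {R : realType}.
Implicit Types x y z : R[i].

(** Unlike [Normc.normc], this contains no square root: it is a polynomial in the real and imaginary
    parts, so identities about it fall to [ring]. *)
Definition normsq z : R := complex.Re z ^+ 2 + complex.Im z ^+ 2.

Lemma normsq_ge0 z : 0 <= normsq z.
Proof. by rewrite addr_ge0 ?sqr_ge0. Qed.

Lemma sqr_normc z : Normc.normc z ^+ 2 = normsq z.
Proof. by case: z => a b; rewrite /normsq /= sqr_sqrtr// addr_ge0 ?sqr_ge0. Qed.

Lemma normc_ge0 z : 0 <= Normc.normc z.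
Proof. by case: z => a b; exact: sqrtr_ge0. Qed.

Lemma ReD x y : complex.Re (x + y) = complex.Re x + complex.Re y.
Proof. by case: x y => [a b] [c e]. Qed.

Lemma ImD x y : complex.Im (x + y) = complex.Im x + complex.Im y.
Proof. by case: x y => [a b] [c e]. Qed.

Lemma ReN x : complex.Re (- x) = - complex.Re x.
Proof. by case: x. Qed.

Lemma ReM x y : complex.Re (x * y) =
  complex.Re x * complex.Re y - complex.Im x * complex.Im y.
Proof. by case: x y => [a b] [c e]. Qed.

Lemma ImM x y : complex.Im (x * y) =
  complex.Re x * complex.Im y + complex.Im x * complex.Re y.
Proof. by case: x y => [a b] [c e]. Qed.

Lemma Re_conjc z : complex.Re (conjc z) = complex.Re z.
Proof. by case: z. Qed.

Lemma Im_conjc z : complex.Im (conjc z) = - complex.Im z.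
Proof. by case: z. Qed.

Lemma Re_real (a : R) : complex.Re (real_complex R a) = a. Proof. by []. Qed.

Lemma Im_real (a : R) : complex.Im (real_complex R a) = 0. Proof. by []. Qed.

Definition ReImE :=
  (ReD, ImD, ReM, ImM, Re_conjc, Im_conjc, Re_real, Im_real).

Lemma complex_eq x y : complex.Re x = complex.Re y ->
  complex.Im x = complex.Im y -> x = y.
Proof. by case: x y => [a b] [c e] /= -> ->. Qed.

Lemma mulc_conjc z : z * conjc z = real_complex R (normsq z).
Proof. by apply: complex_eq; rewrite !ReImE /normsq; ring. Qed.

Lemma conjc_realM (a : R) z :
  conjc (real_complex R a * z) = real_complex R a * conjc z.
Proof. by apply: complex_eq; rewrite !ReImE; ring. Qed.

Lemma normsqM x y : normsq (x * y) = normsq x * normsq y.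
Proof. by rewrite /normsq !ReImE; ring. Qed.

Lemma normsq_real (a : R) : normsq (real_complex R a) = a ^+ 2.
Proof. by rewrite /normsq !ReImE; ring. Qed.

Lemma normc_conjc z : Normc.normc (conjc z) = Normc.normc z.
Proof. by case: z => a b /=; rewrite sqrrN. Qed.

Lemma normcX z n : Normc.normc (z ^+ n) = Normc.normc z ^+ n.
Proof.
by elim: n => [|n IH]; rewrite ?Normc.normc1// !exprS Normc.normcM IH.
Qed.

Lemma normc_le1 z : (Normc.normc z <= 1) = (normsq z <= 1).
Proof. by rewrite -sqr_normc expr_le1// normc_ge0. Qed.

Lemma ler_normRe z : `|complex.Re z| <= Normc.normc z.
Proof.
rewrite -ler_sqr ?nnegrE ?normc_ge0// sqr_normc /normsq real_normK ?num_real//.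
by rewrite lerDl sqr_ge0.
Qed.

Lemma ler_normIm z : `|complex.Im z| <= Normc.normc z.
Proof.
rewrite -ler_sqr ?nnegrE ?normc_ge0// sqr_normc /normsq real_normK ?num_real//.
by rewrite lerDr sqr_ge0.
Qed.

Lemma normsq_circle (z : circle R) : normsq z = 1.
Proof.
case: z => z /=; rewrite normc_def => /eqP[] /(congr1 (fun x : R => x ^+ 2)).
by rewrite sqr_sqrtr ?normsq_ge0 // expr1n.
Qed.

Lemma normc_circle (z : circle R) : Normc.normc z = 1.
Proof.
by apply/eqP; rewrite -(@eqrXn2 _ 2)// ?normc_ge0// sqr_normc normsq_circle expr1n.
Qed.

Lemma circle_mulcJ (z : circle R) : (z : R[i]) * conjc z = 1.
Proof. by rewrite mulc_conjc normsq_circle. Qed.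

End complex_modulus.

(** * Measurability, essential boundedness and linearity of the complex integral *)

Section complex_integral.
Context d {T : measurableType d} {R : realType}.
Variable mu : probability T R.
Implicit Types f g : T -> R[i].

Lemma cmeasurable_cst (a : R[i]) : cmeasurable (fun _ : T => a).
Proof. by split; exact: measurable_cst. Qed.

Lemma cmeasurableD f g : cmeasurable f -> cmeasurable g ->
  cmeasurable (fun x => f x + g x).
Proof.
move=> [fr fi] [gr gi]; split.
  by apply: eq_measurable_fun (measurable_funD fr gr) => x _; rewrite /comp ReD.
by apply: eq_measurable_fun (measurable_funD fi gi) => x _; rewrite /comp ImD.
Qed.

Lemma cmeasurableM f g : cmeasurable f -> cmeasurable g ->
  cmeasurable (fun x => f x * g x).
Proof.
move=> [fr fi] [gr gi]; split.
  apply: eq_measurable_fun (measurable_funB (measurable_funM fr gr)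
    (measurable_funM fi gi)) => x _.
  by rewrite /comp ReM.
apply: eq_measurable_fun (measurable_funD (measurable_funM fr gi)
  (measurable_funM fi gr)) => x _.
by rewrite /comp ImM.
Qed.

Lemma cmeasurable_conjc f : cmeasurable f -> cmeasurable (fun x => conjc (f x)).
Proof.
move=> [fr fi]; split.
  by apply: eq_measurable_fun fr => x _; rewrite /comp Re_conjc.
apply: eq_measurable_fun (measurableT_comp (@oppr_measurable _ _) fi) => x _.
by rewrite /comp Im_conjc.
Qed.

Lemma cmeasurableB f g : cmeasurable f -> cmeasurable g ->
  cmeasurable (fun x => f x - g x).
Proof.
move=> mf mg; have := cmeasurableD mf (cmeasurableM (cmeasurable_cst (-1)) mg).
by under eq_fun do rewrite mulN1r.
Qed.

Lemma measurable_normsq f : cmeasurable f ->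
  measurable_fun setT (fun x => normsq (f x)).
Proof.
by move=> [fr fi]; apply: measurable_funD; apply: (measurable_funX 2).
Qed.

Lemma normcE_sqrt z : Normc.normc z = Num.sqrt (normsq z) :> R.
Proof. by case: z. Qed.

Lemma measurable_normc f : cmeasurable f ->
  measurable_fun setT (fun x => Normc.normc (f x)).
Proof.
move=> mf; under eq_fun do rewrite normcE_sqrt.
apply: measurableT_comp; last exact: measurable_normsq.
by apply: continuous_measurable_fun; exact: sqrt_continuous.
Qed.

(** A class containing both the trigonometric polynomials and the unit ball of L^oo, closed under
    sums, products and conjugation; every function in it is integrable, so it serves as the side
    condition for linearity of [cintegral]. *)
Definition ess_bounded f := cmeasurable f /\
  exists M, \forall x \ae mu, Normc.normc (f x) <= M.

Lemma ess_bounded_cst a : ess_bounded (fun=> a).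
Proof.
by split; [exact: cmeasurable_cst|exists (Normc.normc a); exact: nearW].
Qed.

Lemma ess_boundedD f g : ess_bounded f -> ess_bounded g ->
  ess_bounded (fun x => f x + g x).
Proof.
move=> [mf [M fM]] [mg [N gN]]; split; first exact: cmeasurableD.
exists (M + N); near=> x.
by rewrite (le_trans (le_normcD _ _))// lerD//; near: x.
Unshelve. all: by end_near. Qed.

Lemma ess_boundedM f g : ess_bounded f -> ess_bounded g ->
  ess_bounded (fun x => f x * g x).
Proof.
move=> [mf [M fM]] [mg [N gN]]; split; first exact: cmeasurableM.
exists (M * N); near=> x.
by rewrite Normc.normcM ler_pM ?normc_ge0//; near: x.
Unshelve. all: by end_near. Qed.

Lemma ess_bounded_conjc f : ess_bounded f -> ess_bounded (fun x => conjc (f x)).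
Proof.
move=> [mf [M fM]]; split; first exact: cmeasurable_conjc.
by exists M; near=> x; rewrite normc_conjc; near: x.
Unshelve. all: by end_near. Qed.

Lemma ess_boundedX f n : ess_bounded f -> ess_bounded (fun x => f x ^+ n).
Proof.
move=> bf; elim: n => [|n IH]; first exact: ess_bounded_cst.
by under eq_fun => x do rewrite exprS; exact: ess_boundedM.
Qed.

Lemma ess_bounded_sum I (r : seq I) (F : I -> T -> R[i]) :
  (forall i, ess_bounded (F i)) ->
  ess_bounded (fun x => \sum_(i <- r) F i x).
Proof.
move=> bF; elim: r => [|i r IH].
  by under eq_fun do rewrite big_nil; exact: ess_bounded_cst.
by under eq_fun do rewrite big_cons; exact: ess_boundedD.
Qed.

Lemma ae_bounded_integrable (h : T -> R) M : measurable_fun setT h ->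
  (\forall x \ae mu, `|h x| <= M) -> mu.-integrable setT (EFin \o h).
Proof.
move=> mh hM; apply/integrableP; split; first exact/measurable_EFinP.
have -> : (\int[mu]_x `|(EFin \o h) x| = \int[mu]_x (`|h x|)%:E)%E by [].
(* The absolute value of [M] is used because the sign of [M] is not known and the comparison is
   between nonnegative functions. *)
apply: (@le_lt_trans _ _ (\int[mu]_(x in setT) (`|M|)%:E)%E); last first.
  by rewrite integral_cst// [X in (_ * X)%E]probability_setT mule1 ltry.
apply: ae_ge0_le_integral => //.
  by apply/measurable_EFinP; exact: measurableT_comp.
near=> x => _ /=; rewrite lee_fin (le_trans _ (ler_norm M))//.
by near: x.
Unshelve. all: by end_near. Qed.

Lemma ess_bounded_integrable f : ess_bounded f ->
  mu.-integrable setT (EFin \o (fun x => complex.Re (f x))) /\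
  mu.-integrable setT (EFin \o (fun x => complex.Im (f x))).
Proof.
move=> [[fr fi] [M fM]]; split; apply: (@ae_bounded_integrable _ M) => //.
  by near=> x; rewrite (le_trans (ler_normRe _))//; near: x.
by near=> x; rewrite (le_trans (ler_normIm _))//; near: x.
Unshelve. all: by end_near. Qed.

Lemma ReintE f :
  complex.Re (cintegral mu f) = \int[mu]_x complex.Re (f x).
Proof. by []. Qed.

Lemma ImintE f :
  complex.Im (cintegral mu f) = \int[mu]_x complex.Im (f x).
Proof. by []. Qed.

Lemma cintegral_cst a : cintegral mu (fun=> a) = a.
Proof.
by apply: complex_eq; rewrite !(ReintE, ImintE) Rintegral_cst//
  [X in fine X]probability_setT mulr1.
Qed.

Lemma cintegralD f g : ess_bounded f -> ess_bounded g ->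
  cintegral mu (fun x => f x + g x) = cintegral mu f + cintegral mu g.
Proof.
move=> /ess_bounded_integrable[fr fi] /ess_bounded_integrable[gr gi].
apply: complex_eq; rewrite ?ReD ?ImD !(ReintE, ImintE) -RintegralD//;
  by apply: eq_Rintegral => x _; rewrite !ReImE.
Qed.

Lemma cintegralZ a f : ess_bounded f ->
  cintegral mu (fun x => a * f x) = a * cintegral mu f.
Proof.
move=> /ess_bounded_integrable[fr fi].
have intZ r (h : T -> R) : mu.-integrable setT (EFin \o h) ->
    mu.-integrable setT (EFin \o (fun x => r * h x)).
  by move=> ih; exact: (integrableZl measurableT r ih).
apply: complex_eq; rewrite ?ReM ?ImM !(ReintE, ImintE) -!RintegralZl//.
  rewrite -RintegralB//; try exact: intZ.
  by apply: eq_Rintegral => x _; rewrite !ReImE.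
rewrite -RintegralD//; try exact: intZ.
by apply: eq_Rintegral => x _; rewrite !ReImE.
Qed.

Lemma cintegral_sum I (r : seq I) (F : I -> T -> R[i]) :
  (forall i, ess_bounded (F i)) ->
  cintegral mu (fun x => \sum_(i <- r) F i x) = \sum_(i <- r) cintegral mu (F i).
Proof.
move=> bF; elim: r => [|i r IH].
  by under eq_fun do rewrite big_nil; rewrite big_nil cintegral_cst.
under eq_fun do rewrite big_cons.
rewrite big_cons -IH cintegralD//.
exact: ess_bounded_sum.
Qed.

Lemma cintegral_conjc f : ess_bounded f ->
  cintegral mu (fun x => conjc (f x)) = conjc (cintegral mu f).
Proof.
move=> /ess_bounded_integrable[fr fi].
apply: complex_eq; rewrite ?Re_conjc ?Im_conjc !(ReintE, ImintE).
  by apply: eq_Rintegral => x _; rewrite !ReImE.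
rewrite -mulN1r -RintegralZl//.
by apply: eq_Rintegral => x _; rewrite !ReImE mulN1r.
Qed.

End complex_integral.

(** * Moments of the normalized measure on the circle *)

Section circle_moments.
Context {R : realType}.
Local Notation sigma := (sigma1 R).

Lemma cmeasurable_circle : cmeasurable (fun z : circle R => z : R[i]).
Proof.
have mcoord : measurable_fun setT (@circle_coord R).
  by move=> _ B mB; rewrite setTI; exists B => //; rewrite setTI.
by split; [exact: measurableT_comp measurable_fst mcoord
          |exact: measurableT_comp measurable_snd mcoord].
Qed.

Lemma ess_bounded_circle : ess_bounded sigma (fun z : circle R => z : R[i]).
Proof.
split; first exact: cmeasurable_circle.
by exists 1; apply: nearW => z; rewrite normc_circle.
Qed.

Lemma cis_exp (t : R) n :
  (cis t : R[i]) ^+ n = Complex (cos (n%:R * t)) (sin (n%:R * t)).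
Proof.
elim: n => [|n IH]; first by rewrite expr0 mul0r cos0 sin0.
rewrite exprS IH -natr1 mulrDl mul1r cosD sinD.
by apply: complex_eq; rewrite ReImE /=; ring.
Qed.

Lemma ge0_integral_sigma1 (h : circle R -> R) : measurable_fun setT h ->
  (forall z, 0 <= h z) ->
  (\int[sigma]_z (h z)%:E =
   ((2 * pi)^-1)%R%:E * \int[lebesgue_measure]_(t in `[0%R, (2 * pi)%R]) (h (cis t))%:E)%E.
Proof.
move=> mh h0; rewrite ge0_integral_distribution//=; last first.
  exact/measurable_EFinP.
rewrite integral_uniform ?subr0// => [|t]; last by rewrite lee_fin.
apply/measurable_EFinP; apply: measurableT_comp mh _.
exact: measurable_cis.
Qed.

(** The fundamental theorem of calculus on [0, 2 pi], after the change of variables z = e^(it). *)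
Lemma integral_sigma1_primitive (h : circle R -> R) (F : R -> R) :
  measurable_fun setT h -> (forall z, 0 <= h z) ->
  continuous (fun t => h (cis t)) ->
  (forall t : R, is_derive t 1 F (h (cis t))) ->
  (\int[sigma]_z (h z)%:E = ((F (2 * pi) - F 0) / (2 * pi))%R%:E)%E.
Proof.
move=> mh h0 ch dF; rewrite ge0_integral_sigma1//.
have cF : continuous F.
  move=> t; apply: differentiable_continuous; apply/derivable1_diffP.
  by have [] := dF t.
rewrite (@continuous_FTC2 _ _ F) ?twopi_gt0//.
- by rewrite -EFinB -EFinM mulrC.
- by apply: continuous_subspaceT.
- split; [by move=> t _; have [] := dF t| |].
  + by apply: cvg_at_right_filter; exact: cF.
  + by apply: cvg_at_left_filter; exact: cF.
- by move=> t _; rewrite derive1E; have [] := dF t.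
Qed.

Lemma cos_nat_2pi n : cos (n%:R * (2 * pi)) = 1 :> R.
Proof.
elim: n => [|n IH]; first by rewrite mul0r cos0.
by rewrite -natr1 mulrDl mul1r (mulr_natl pi 2) cosD2pi -(mulr_natl pi 2).
Qed.

Lemma sin_nat_2pi n : sin (n%:R * (2 * pi)) = 0 :> R.
Proof.
elim: n => [|n IH]; first by rewrite mul0r sin0.
by rewrite -natr1 mulrDl mul1r (mulr_natl pi 2) sinD2pi -(mulr_natl pi 2).
Qed.

(** Adding 1 makes the integrands nonnegative, as [integral_sigma1_primitive] requires; the 1 is
    subtracted again in [cintegral_circleX]. *)
Lemma integral_circle_cos_sin n : (0 < n)%N ->
  (\int[sigma]_z (1 + complex.Re ((z : R[i]) ^+ n))%:E = 1 /\
   \int[sigma]_z (1 + complex.Im ((z : R[i]) ^+ n))%:E = 1)%E.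
Proof.
move=> n0; have n0' : n%:R != 0 :> R by rewrite pnatr_eq0 -lt0n.
have [[mr mi] _] := ess_boundedX n ess_bounded_circle.
have bd (z : circle R) : Normc.normc ((z : R[i]) ^+ n) <= 1.
  by rewrite normcX normc_circle expr1n.
have twopi0 : 2 * pi != 0 :> R by rewrite gt_eqF// twopi_gt0.
split.
- have dF (t : R) : is_derive t 1 (fun t : R => t + n%:R^-1 * sin (n%:R * t))
      (1 + complex.Re ((cis t : R[i]) ^+ n)).
    rewrite cis_exp /=; apply: is_derive_eq.
    by rewrite /GRing.scale /=; field.
  rewrite (integral_sigma1_primitive _ _ _ dF).
  + by rewrite sin_nat_2pi !mulr0 sin0 mulr0 !addr0 subr0 divff.
  + exact: measurable_funD.
  + move=> z; have := le_trans (ler_normRe _) (bd z).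
    by rewrite ler_norml => /andP[? _]; lra.
  + move=> t; under eq_fun do rewrite cis_exp /=.
    apply: cvgD; first exact: cvg_cst.
    by apply: continuous_comp; [exact: mulrl_continuous|exact: continuous_cos].
- have dF (t : R) : is_derive t 1 (fun t : R => t - n%:R^-1 * cos (n%:R * t))
      (1 + complex.Im ((cis t : R[i]) ^+ n)).
    rewrite cis_exp /=; apply: is_derive_eq.
    by rewrite /GRing.scale /=; field.
  rewrite (integral_sigma1_primitive _ _ _ dF).
  + by rewrite cos_nat_2pi !mulr0 cos0 mulr1 sub0r opprK subrK divff.
  + exact: measurable_funD.
  + move=> z; have := le_trans (ler_normIm _) (bd z).
    by rewrite ler_norml => /andP[? _]; lra.
  + move=> t; under eq_fun do rewrite cis_exp /=.
    apply: cvgD; first exact: cvg_cst.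
    by apply: continuous_comp; [exact: mulrl_continuous|exact: continuous_sin].
Qed.

Lemma cintegral_circleX n : cintegral sigma (fun z => (z : R[i]) ^+ n) = (n == 0%N)%:R.
Proof.
have [->|n0] := eqVneq n 0%N; first by rewrite (cintegral_cst sigma 1).
have [hr hi] := integral_circle_cos_sin (ltac:(by rewrite lt0n) : (0 < n)%N).
have [ir ii] := ess_bounded_integrable (ess_boundedX n ess_bounded_circle).
have i1 : sigma.-integrable setT (EFin \o cst (1 : R)).
  by apply: finite_measure_integrable_cst.
have sub1 (h : circle R -> R) : sigma.-integrable setT (EFin \o h) ->
    (\int[sigma]_z (1 + h z)%:E = 1)%E -> \int[sigma]_z h z = 0.
  move=> ih /(congr1 fine); rewrite -[fine _]/(Rintegral _ _ _) RintegralD//.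
  rewrite Rintegral_cst// [X in 1 * fine X]probability_setT mulr1 /=.
  by move=> /eqP; rewrite -subr_eq0 addrAC subrr add0r => /eqP.
by apply: complex_eq; rewrite !(ReintE, ImintE) sub1.
Qed.

(** Orthogonality of the characters: on the circle conj z is the inverse of z, so the integrand
    collapses to a power of z or of conj z, according to which exponent is larger. *)
Lemma cintegral_moment m n :
  cintegral sigma (fun z => (z : R[i]) ^+ m * conjc (z : R[i]) ^+ n) = (m == n)%:R.
Proof.
have red a b (z : circle R) :
    (z : R[i]) ^+ (a + b) * conjc (z : R[i]) ^+ a = (z : R[i]) ^+ b.
  by rewrite exprD mulrAC -exprMn circle_mulcJ expr1n mul1r.
have [mn|nm] := leqP m n; last first.
  have -> : (fun z : circle R => (z : R[i]) ^+ m * conjc (z : R[i]) ^+ n)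
      = (fun z => (z : R[i]) ^+ (m - n)).
    by apply/funext => z; rewrite -{1}(subnKC (ltnW nm)) red.
  by rewrite cintegral_circleX subn_eq0 leqNgt nm (gtn_eqF nm).
rewrite -(subnKC mn).
have -> : (fun z : circle R => (z : R[i]) ^+ m * conjc (z : R[i]) ^+ (m + (n - m)))
    = (fun z => conjc ((z : R[i]) ^+ (n - m))).
  apply/funext => z; rewrite rmorphXn /= exprD mulrA -exprMn circle_mulcJ.
  by rewrite expr1n mul1r.
rewrite cintegral_conjc ?cintegral_circleX; last first.
  exact: ess_boundedX ess_bounded_circle.
by rewrite conjc_nat (subnKC mn) subn_eq0 eqn_leq mn.
Qed.

End circle_moments.

(** * The quartic inequality and the bound on Fejer sums *)

Section fejer.
Context {R : realType}.
Local Notation sigma := (sigma1 R).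
Implicit Types p q : {poly R[i]}.

Lemma ess_bounded_horner p : ess_bounded sigma (fun z : circle R => p.[z : R[i]]).
Proof.
under eq_fun do rewrite horner_coef.
apply: ess_bounded_sum => i; apply: ess_boundedM; first exact: ess_bounded_cst.
exact: ess_boundedX ess_bounded_circle.
Qed.

(** The mean value property at 0: all positive powers of z integrate to 0. *)
Lemma cintegral_horner p : cintegral sigma (fun z => p.[z : R[i]]) = p`_0.
Proof.
under eq_fun do rewrite horner_coef.
rewrite cintegral_sum; last first.
  move=> i; apply: ess_boundedM; first exact: ess_bounded_cst.
  exact: ess_boundedX ess_bounded_circle.
transitivity (\sum_(i < size p) p`_i * (0 == i)%N%:R).
  apply: eq_bigr => i _; rewrite cintegralZ ?cintegral_circleX 1?eq_sym//.
  exact: ess_boundedX ess_bounded_circle.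
have [->|p0] := eqVneq p 0; first by rewrite size_poly0 big_ord0 coef0.
have sp : (0 < size p)%N by rewrite lt0n size_poly_eq0.
rewrite (bigD1 (Ordinal sp))//= mulr1 big1 ?addr0// => i.
by rewrite -val_eqE /= eq_sym => /negbTE ->; rewrite mulr0.
Qed.

(** With F = g + conj h, one has |F|^2 = |g|^2 + |h|^2 + 2 Re (g h), and the difference of the two
    sides factors as (1 - |F|^2)(1 - |F|^2 + 2(|g|^2 + |h|^2)) + |h|^4, a sum of nonnegative
    terms. *)
Lemma normsq_sum_quartic (g h : R[i]) : normsq (g + conjc h) <= 1 ->
  normsq g ^+ 2 <= 1 - 4 * complex.Re (g * h) + 2 * complex.Re ((g * h) ^+ 2).
Proof.
move=> F1; have G0 := normsq_ge0 g; have H0 := normsq_ge0 h.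
rewrite -subr_ge0.
have -> : 1 - 4 * complex.Re (g * h) + 2 * complex.Re ((g * h) ^+ 2)
    - normsq g ^+ 2
  = (1 - normsq (g + conjc h))
      * (1 - normsq (g + conjc h) + 2 * (normsq g + normsq h))
    + normsq h ^+ 2.
  by rewrite expr2 /normsq !ReImE; ring.
rewrite addr_ge0 ?sqr_ge0// mulr_ge0 ?subr_ge0//.
by rewrite addr_ge0 ?subr_ge0// mulr_ge0// addr_ge0.
Qed.

(** Here h = z q(z), so the majorant of [normsq_sum_quartic] is the real part of a polynomial [P] in
    z whose constant term is 1. *)
Lemma integral_quartic_poly p q :
  (forall z : circle R,
    normsq (p.[z : R[i]] + conjc ((z : R[i]) * q.[z : R[i]])) <= 1) ->
  (\int[sigma]_z (normsq p.[z : R[i]] ^+ 2)%:E <= 1)%E.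
Proof.
move=> pq1; pose r : {poly R[i]} := p * ('X * q).
pose P : {poly R[i]} := 1 - r *+ 4 + r ^+ 2 *+ 2.
have PE (z : R[i]) :
    P.[z] = 1 - (p.[z] * (z * q.[z])) *+ 4 + (p.[z] * (z * q.[z])) ^+ 2 *+ 2.
  rewrite /P /r !(hornerD, hornerN, hornerMn, horner_exp, hornerM, hornerX).
  by rewrite -polyC1 hornerC.
have ReMn (x : R[i]) n : complex.Re (x *+ n) = n%:R * complex.Re x.
  by elim: n => [|n IH]; rewrite ?mulr0n ?mul0r// mulrS ReD IH -nat1r mulrDl mul1r.
have [iP _] := ess_bounded_integrable (ess_bounded_horner P).
have P0 : complex.Re (cintegral sigma (fun z : circle R => P.[z : R[i]])) = 1.
  rewrite cintegral_horner -horner_coef0 PE.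
  by rewrite mul0r mulr0 mul0rn subr0 expr0n mul0rn addr0.
apply: (@le_trans _ _ (\int[sigma]_z (complex.Re P.[z : R[i]])%:E)%E); last first.
  by rewrite -[leLHS]fineK ?integrable_fin_num// -[fine _]/(Rintegral _ _ _) -ReintE P0.
apply: ge0_le_integral => //.
- by move=> z _; rewrite lee_fin sqr_ge0.
- apply/measurable_EFinP; apply: (measurable_funX 2).
  by apply: measurable_normsq; have [] := ess_bounded_horner p.
- by have /measurable_int := iP.
- move=> z _; rewrite lee_fin PE; rewrite !ReD ReN !ReMn.
  rewrite -mulr2n -[_ *+ 2]mulr_natl.
  exact: normsq_sum_quartic (pq1 z).
Qed.

Lemma circle_exprzB (z : circle R) m n :
  (z : R[i]) ^ (m%:Z - n%:Z) = (z : R[i]) ^+ m * conjc (z : R[i]) ^+ n.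
Proof.
have z1 := circle_mulcJ z.
have z0 : (z : R[i]) != 0.
  by apply: contra_eq_neq z1 => ->; rewrite mul0r eq_sym oner_neq0.
rewrite expfzDr// -exprnP; congr (_ * _).
by rewrite -exprnN -exprVn; congr (_ ^+ n); apply: (mulfI z0); rewrite divff.
Qed.

Lemma ae_ler_Rintegral d (T : measurableType d) (mu : {measure set T -> \bar R})
    (h k : T -> R) :
  mu.-integrable setT (EFin \o h) -> mu.-integrable setT (EFin \o k) ->
  (forall x, 0 <= k x) -> (\forall x \ae mu, `|h x| <= k x) ->
  \int[mu]_x h x <= \int[mu]_x k x.
Proof.
move=> ih ik k0 hk; apply: (le_trans (ler_norm _)).
apply: (le_trans (le_normr_Rintegral _ ih)) => //.
have inh : mu.-integrable setT (EFin \o (fun x => `|h x|)).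
  exact: integrable_abse ih.
apply: fine_le; rewrite ?integrable_fin_num//.
apply: ae_ge0_le_integral => //.
- by have /measurable_int := inh.
- by move=> x _; rewrite lee_fin.
- by have /measurable_int := ik.
- by near=> x => _; rewrite lee_fin; near: x.
Unshelve. all: by end_near. Qed.

(* N times the Fejer mean of order N: on the circle z^j conj(z)^l = z^(j-l). *)
Definition fejer_sum (f : circle R -> R[i]) N (z : circle R) : R[i] :=
  \sum_(j < N) \sum_(l < N)
    fourier_coef f (j%:Z - l%:Z) * ((z : R[i]) ^+ j * conjc (z : R[i]) ^+ l).

(** The sum is the integral of f against a nonnegative kernel of total mass N. The bound therefore
    holds at every z, although f is bounded only almost everywhere. *)
Lemma normc_fejer_sum f N z : cmeasurable f ->
  (\forall w \ae sigma, Normc.normc (f w) <= 1) ->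
  Normc.normc (fejer_sum f N z) <= N%:R.
Proof.
move=> mf f1; have bf : ess_bounded sigma f by split=> //; exists 1.
have bz := ess_bounded_circle (R := R).
have bzc := ess_bounded_conjc bz.
(* |D|^2 is N times the Fejer kernel *)
pose D (w : circle R) : R[i] := \sum_(j < N) ((z : R[i]) ^+ j * conjc (w : R[i]) ^+ j).
have DE w : D w * conjc (D w) = \sum_(j < N) \sum_(l < N)
    ((z : R[i]) ^+ j * conjc (z : R[i]) ^+ l) *
    ((w : R[i]) ^+ l * conjc (w : R[i]) ^+ j).
  rewrite /D rmorph_sum mulr_suml; apply: eq_bigr => j _.
  rewrite mulr_sumr; apply: eq_bigr => l _.
  by rewrite rmorphM !rmorphXn /= conjcK; ring.
have bD : ess_bounded sigma D.
  apply: ess_bounded_sum => j; apply: ess_boundedM; first exact: ess_bounded_cst.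
  exact: ess_boundedX.
have bDD : ess_bounded sigma (fun w => D w * conjc (D w)).
  by apply: ess_boundedM => //; exact: ess_bounded_conjc.
have bzz l j : ess_bounded sigma
    (fun w : circle R => (w : R[i]) ^+ l * conjc (w : R[i]) ^+ j).
  by apply: ess_boundedM; exact: ess_boundedX.
have intDD : \int[sigma]_w normsq (D w) = N%:R.
  have -> : \int[sigma]_w normsq (D w)
      = complex.Re (cintegral sigma (fun w => D w * conjc (D w))).
    by rewrite ReintE; apply: eq_Rintegral => w _; rewrite mulc_conjc.
  have -> : cintegral sigma (fun w => D w * conjc (D w)) = \sum_(j < N) 1.
    under eq_fun do rewrite DE.
    rewrite cintegral_sum; last first.
      move=> j; apply: ess_bounded_sum => l.
      by apply: ess_boundedM => //; exact: ess_bounded_cst.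
    apply: eq_bigr => j _; rewrite cintegral_sum; last first.
      by move=> l; apply: ess_boundedM => //; exact: ess_bounded_cst.
    (* By orthogonality only l = j survives, with coefficient |z^j|^2 = 1; summing over j gives
       N. *)
    rewrite (bigD1 j)//= big1 ?addr0 => [|l lj].
      rewrite cintegralZ// cintegral_moment eqxx mulr1.
      by rewrite -exprMn circle_mulcJ expr1n.
    by rewrite cintegralZ// cintegral_moment (negbTE (lj : (l : nat) != j)) mulr0.
  rewrite sumr_const card_ord; elim: N {D DE bD bDD} => // n IH.
  by rewrite mulrS ReD IH mulrS.
have fejerE : fejer_sum f N z = cintegral sigma (fun w => f w * (D w * conjc (D w))).
  under [in RHS]eq_fun => w do rewrite DE mulr_sumr.
  under [in RHS]eq_fun => w do under eq_bigr => j _ do rewrite mulr_sumr.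
  rewrite cintegral_sum; last first.
    move=> j; apply: ess_bounded_sum => l; apply: ess_boundedM => //.
    by apply: ess_boundedM => //; exact: ess_bounded_cst.
  apply: eq_bigr => j _; rewrite cintegral_sum; last first.
    move=> l; apply: ess_boundedM => //.
    by apply: ess_boundedM => //; exact: ess_bounded_cst.
  apply: eq_bigr => l _; rewrite mulrC /fourier_coef -cintegralZ; last first.
    apply: ess_boundedM => //.
    under eq_fun do rewrite circle_exprzB.
    exact: ess_bounded_conjc.
  congr (cintegral _ _); apply/funext => w; rewrite circle_exprzB.
  by rewrite rmorphM !rmorphXn /= conjcK; ring.
set I := fejer_sum f N z in fejerE *.
have [->|Ineq0] := eqVneq I 0; first by rewrite Normc.normc0.
have I0 : 0 < Normc.normc I.
  by rewrite lt_def normc_ge0 andbT; apply: contra_neq Ineq0; exact: Normc.eq0_normc.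
(* The triangle inequality for a complex integral, by duality: |I|^2 = Re (conj I * I) is the
   integral of Re (conj I f |D|^2), which is at most |I| times the integral of |D|^2. *)
rewrite -(ler_pM2l I0) -expr2 sqr_normc.
have -> : normsq I = complex.Re (conjc I * I) by rewrite mulrC mulc_conjc.
rewrite {2}fejerE -cintegralZ; last exact: ess_boundedM.
rewrite ReintE -intDD -RintegralZl//; last first.
  have [+ _] := ess_bounded_integrable bDD; congr (integrable _ _ _).
  by apply/funext => w /=; rewrite mulc_conjc.
apply: ae_ler_Rintegral.
- have bI := ess_boundedM (ess_bounded_cst _ (conjc I)) (ess_boundedM bf bDD).
  by have [] := ess_bounded_integrable bI.
- have [+ _] := ess_bounded_integrable
    (ess_boundedM (ess_bounded_cst _ (real_complex R (Normc.normc I))) bDD).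
  congr (integrable _ _ _).
  by apply/funext => w /=; rewrite mulc_conjc ReM !ReImE mul0r subr0.
- by move=> w; rewrite mulr_ge0 ?normc_ge0 ?normsq_ge0.
near=> w.
rewrite (le_trans (ler_normRe _))// !Normc.normcM !normc_conjc.
rewrite ler_pM2l// -expr2 sqr_normc ler_piMl ?normsq_ge0//.
by near: w.
Unshelve. all: by end_near. Qed.

End fejer.

(** * Analytic and antianalytic parts of the Fejer sums *)

Section fejer_decomposition.
Context {R : realType}.
Local Notation sigma := (sigma1 R).

(** Passing from N to N + 1 adds a row j = N and a column l = N to the double sum. The row, diagonal
    term included, carries the frequencies 0 to N and equals [riesz_sum f N.+1]; the column carries
    the frequencies -N to -1. *)
Lemma fejer_sum_decomp (f : circle R -> R[i]) N : exists q : {poly R[i]},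
  forall z : circle R, fejer_sum f N z =
    \sum_(n < N) riesz_sum f n.+1 z + conjc ((z : R[i]) * q.[z : R[i]]).
Proof.
elim: N => [|N [q IH]].
  exists 0 => z; rewrite /fejer_sum !big_ord0 horner0 mulr0.
  by rewrite rmorph0 addr0.
(* The predecessor in the exponent makes room for the factor z in front of q, and the coefficients
   are conjugated because the whole product is. *)
exists (q + \sum_(j < N) (conjc (fourier_coef f (j%:Z - N%:Z))) *: 'X^((N - j).-1)).
move=> z; rewrite /fejer_sum big_ord_recr /=.
under eq_bigr do rewrite big_ord_recr /=.
rewrite big_split /= -[X in X + _ + _]/(fejer_sum f N z) IH.
rewrite [in RHS]big_ord_recr /= hornerD mulrDr rmorphD /=.
rewrite [LHS](AC ((1*1)*1*1) (1*4*(2*3)))/=; congr (_ + _ + (_ + _)).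
- rewrite /riesz_sum big_mkord (reindex_inj rev_ord_inj) /=.
  apply: eq_bigr => k _; rewrite subSS.
  have kN : (k <= N)%N by rewrite -ltnS.
  have -> : N%:Z - (N - k)%N%:Z = k%:Z by rewrite -subzn// opprB addrC subrK.
  congr (_ * _); rewrite -{1}(subnK kN).
  by rewrite exprD mulrAC -exprMn circle_mulcJ expr1n mul1r.
rewrite horner_sum mulr_sumr rmorph_sum; apply: eq_bigr => j _.
rewrite hornerZ hornerXn [in RHS]mulrCA -exprS prednK ?subn_gt0//.
rewrite rmorphM rmorphXn; congr (_ * _); first exact: esym (conjcK _).
rewrite -{2}(subnKC (ltnW (ltn_ord j))) exprD mulrA -exprMn circle_mulcJ.
by rewrite expr1n mul1r.
Qed.

(** By [fejer_sum_decomp] this is the analytic part of the Fejer mean of order N, seen as the Cesaro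
    mean of the partial sums with 1 to N terms. *)
Definition fejer_riesz (f : circle R -> R[i]) N (z : circle R) : R[i] :=
  real_complex R (N%:R^-1) * \sum_(n < N) riesz_sum f n.+1 z.

Lemma riesz_sumE f n (z : circle R) :
  riesz_sum f n z = (\poly_(k < n) fourier_coef f k%:Z).[z : R[i]].
Proof. by rewrite horner_poly /riesz_sum big_mkord. Qed.

Lemma fejer_rieszE f N (z : circle R) : fejer_riesz f N z =
  ((real_complex R (N%:R^-1))%:P *
    \sum_(n < N) \poly_(k < n.+1) fourier_coef f k%:Z).[z : R[i]].
Proof.
rewrite hornerM hornerC horner_sum; congr (_ * _).
by apply: eq_bigr => n _; exact: riesz_sumE.
Qed.

(** Dividing the decomposition by N writes the Fejer mean as p + conj (z q) with p and q
    polynomials, and its modulus is at most 1 on the whole circle. *)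
Lemma integral_quartic_fejer_riesz f N : (0 < N)%N -> cmeasurable f ->
  (\forall w \ae sigma, Normc.normc (f w) <= 1) ->
  (\int[sigma]_z (normsq (fejer_riesz f N z) ^+ 2)%:E <= 1)%E.
Proof.
move=> N0 mf f1; have [q fE] := fejer_sum_decomp f N.
under eq_integral do rewrite fejer_rieszE.
apply: (@integral_quartic_poly _ _ ((real_complex R (N%:R^-1))%:P * q)) => z.
rewrite -fejer_rieszE /fejer_riesz hornerM hornerC [_ * (_ * q.[_])]mulrCA conjc_realM.
rewrite -mulrDr -fE normsqM normsq_real -sqr_normc -exprMn expr_le1//.
- by rewrite ler_pdivrMl ?ltr0n// mulr1 normc_fejer_sum.
- by rewrite mulr_ge0 ?invr_ge0 ?normc_ge0.
Qed.

End fejer_decomposition.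

(** * L^p norms over a probability space *)

Section cLnorm_theory.
Context d {T : measurableType d} {R : realType}.
Variable mu : probability T R.
Implicit Types f g : T -> R[i].

Lemma cLnormE (p : R) f :
  cLnorm mu p%:E f = ((\int[mu]_x (Normc.normc (f x) `^ p)%:E) `^ p^-1)%E.
Proof.
rewrite /cLnorm unlock; congr poweR; apply: eq_integral => x _ /=.
by rewrite ger0_norm// normc_ge0.
Qed.

Lemma cLnorm_le1 (p : R) f : 0 < p ->
  (\int[mu]_x (Normc.normc (f x) `^ p)%:E <= 1)%E -> (cLnorm mu p%:E f <= 1)%E.
Proof.
move=> p0 If; rewrite cLnormE -[leRHS](poweR1r p^-1).
rewrite gt0_ler_poweR ?invr_ge0 ?(ltW p0)// in_itv/= ?leey ?andbT//.
by apply: integral_ge0 => x _; rewrite lee_fin powR_ge0.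
Qed.

Lemma integral_normsq f :
  (\int[mu]_x (normsq (f x))%:E = cLnorm mu 2%:E f `^ 2)%E.
Proof.
rewrite cLnormE -poweRrM mulVf// poweRe1; last first.
  by apply: integral_ge0 => x _; rewrite lee_fin powR_ge0.
by apply: eq_integral => x _; rewrite powR_mulrn ?normc_ge0// sqr_normc.
Qed.

(** Pointwise |f| <= 1 + |f|^2, and constants are integrable for a probability measure. *)
Lemma in_cL2_integrable f : in_cLp mu 2%:E f ->
  mu.-integrable setT (EFin \o (fun x => Normc.normc (f x))).
Proof.
move=> [mf f2]; have mn := measurable_normsq mf.
have ins : mu.-integrable setT (EFin \o (fun x => normsq (f x))).
  apply/integrableP; split; first exact/measurable_EFinP.
  under eq_integral do rewrite /= ger0_norm ?normsq_ge0//.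
  by rewrite integral_normsq poweR_lty.
have i1 : mu.-integrable setT (EFin \o cst (1 : R)).
  exact: finite_measure_integrable_cst.
apply: (le_integrable _ _ _ (integrableD measurableT i1 ins)) => //.
  by apply/measurable_EFinP; exact: measurable_normc.
move=> x _; have n0 := normsq_ge0 (f x).
rewrite /= lee_fin (ger0_norm (normc_ge0 _)) ger0_norm; last by lra.
by rewrite -sqr_normc; have := normc_ge0 (f x); nra.
Qed.

(** A substitute for Cauchy-Schwarz: integrating |f| <= e + |f|^2 / e costs only the factor 2. *)
Lemma Rintegral_normc_le f (e : R) : 0 < e -> cmeasurable f ->
  (cLnorm mu 2%:E f <= e%:E)%E -> \int[mu]_x Normc.normc (f x) <= 2 * e.
Proof.
move=> e0 mf fe; have f2 : in_cLp mu 2%:E f by split=> //; exact: le_lt_trans fe (ltry _).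
have ifn := in_cL2_integrable f2; have mn := measurable_normsq mf.
rewrite -lee_fin /Rintegral fineK ?integrable_fin_num//.
apply: (@le_trans _ _ (\int[mu]_x (e%:E + (e^-1)%:E * (normsq (f x))%:E))%E).
  apply: ge0_le_integral => //.
  - by move=> x _; rewrite lee_fin normc_ge0.
  - by have /measurable_int := ifn.
  - by apply/measurable_EFinP; apply: measurable_funD => //; apply: measurable_funM.
  move=> x _; rewrite -EFinM -EFinD lee_fin -sqr_normc.
  rewrite -(ler_pM2l e0) mulrDr mulrA divff ?gt_eqF// mul1r.
  by have := normc_ge0 (f x); nra.
rewrite ge0_integralD//; last 3 first.
- by move=> x _; rewrite lee_fin ltW.
- by move=> x _; rewrite -EFinM lee_fin mulr_ge0 ?normsq_ge0 ?invr_ge0 ?ltW.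
- by apply/measurable_EFinP; apply: measurable_funM.
rewrite integral_cst// [X in (_ * X + _)%E]probability_setT mule1.
rewrite ge0_integralZl//; last 3 first.
- exact/measurable_EFinP.
- by move=> x _; rewrite lee_fin normsq_ge0.
- by rewrite lee_fin invr_ge0 ltW.
rewrite integral_normsq (_ : 2 * e = e + e); last by ring.
rewrite (EFinD e e); apply: leeD2l.
have -> : e%:E = (e^-1%:E * (e%:E `^ 2))%E.
  by rewrite poweR_EFin powR_mulrn ?(ltW e0)// -EFinM expr2 mulrA mulVf ?mul1r// gt_eqF.
apply: lee_pmul; rewrite ?poweR_ge0// ?lee_fin ?invr_ge0 ?(ltW e0)//.
apply: gt0_ler_poweR => //.
- by rewrite in_itv/= leey andbT Lnorm_ge0.
- by rewrite in_itv/= leey andbT lee_fin ltW.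
Qed.

Lemma Rintegral_sum I (s : seq I) (h : I -> T -> R) :
  (forall i, mu.-integrable setT (EFin \o h i)) ->
  \int[mu]_x (\sum_(i <- s) h i x) = \sum_(i <- s) \int[mu]_x h i x.
Proof.
move=> ih; rewrite /Rintegral.
under eq_integral do rewrite -sumEFin.
rewrite integral_sum// -sum_fine// => i _.
by apply: integrable_fin_num; first exact: measurableT; exact: ih.
Qed.

End cLnorm_theory.

(** * Passing from Fejer means to the L^2 limit g of the partial sums *)

Section riesz_limit.
Context {R : realType}.
Local Notation sigma := (sigma1 R).
Variables f g : circle R -> R[i].
Hypotheses (mf : cmeasurable f)
  (f1 : \forall w \ae sigma, Normc.normc (f w) <= 1)
  (g2 : in_cLp sigma 2%:E g)
  (fg : cLnorm sigma 2%:E (fun z => g z - riesz_sum f n z) @[n --> \oo] --> 0%E).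

Lemma ess_bounded_riesz_sum n : ess_bounded sigma (riesz_sum f n).
Proof. by rewrite (funext (riesz_sumE f n)); exact: ess_bounded_horner. Qed.

Lemma cmeasurable_fejer_riesz n : cmeasurable (fejer_riesz f n).
Proof.
suff [] : ess_bounded sigma (fejer_riesz f n) by [].
by rewrite (funext (fejer_rieszE f n)); exact: ess_bounded_horner.
Qed.

(** The shift to [n.+1] matches the partial sums averaged in [fejer_riesz]. *)
Let h n z := Normc.normc (g z - riesz_sum f n.+1 z).
Let u n := \int[sigma]_z h n z.

Let ih n : sigma.-integrable setT (EFin \o h n).
Proof.
have ig := in_cL2_integrable g2.
have [mS [M SM]] := ess_bounded_riesz_sum n.+1.
have iS : sigma.-integrable setT (EFin \o (fun z => Normc.normc (riesz_sum f n.+1 z))).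
  apply: (@ae_bounded_integrable _ _ _ _ _ M); first exact: measurable_normc.
  by near=> z; rewrite ger0_norm ?normc_ge0//; near: z.
apply: (le_integrable _ _ _ (integrableD measurableT ig iS)) => //.
  apply/measurable_EFinP; apply: measurable_normc; apply: cmeasurableB => //.
  by have [] := g2.
move=> z _; rewrite /= lee_fin !ger0_norm ?addr_ge0 ?normc_ge0//.
by rewrite (le_trans (le_normcD _ _))// normcN.
Unshelve. all: by end_near. Qed.

(** Convergence in L^2 implies convergence in L^1, by [Rintegral_normc_le]. *)
Let u_cvg0 : u @ \oo --> 0.
Proof.
rewrite (cvg_shiftS (fun n => \int[sigma]_z Normc.normc (g z - riesz_sum f n z))).
have /fine_cvgP[ffin fcvg] := fg.
apply/cvgrPdist_le => e e0.
have e20 : 0 < e / 2 by rewrite divr_gt0.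
move/cvgrPdist_le : fcvg => /(_ _ e20) fle.
near=> n.
rewrite sub0r normrN ger0_norm ?Rintegral_ge0//; last by move=> z _; exact: normc_ge0.
have -> : e = 2 * (e / 2) by rewrite mulrC divfK.
apply: Rintegral_normc_le => //.
  by apply: cmeasurableB; [have [] := g2|have [] := ess_bounded_riesz_sum n].
have fn : cLnorm sigma 2 (fun z => g z - riesz_sum f n z) \is a fin_num by near: n.
rewrite -(fineK fn) lee_fin (le_trans (ler_norm _))// -normrN -sub0r.
by near: n.
Unshelve. all: by end_near. Qed.

(** The difference g - [fejer_riesz f n.+1] is the average of the n + 1 differences whose moduli are
    [h 0], ..., [h n], so the triangle inequality applies. *)
Lemma Rintegral_fejer_riesz n :
  \int[sigma]_z Normc.normc (g z - fejer_riesz f n.+1 z) <= arithmetic_mean u n /\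
  sigma.-integrable setT (EFin \o (fun z => Normc.normc (g z - fejer_riesz f n.+1 z))).
Proof.
have le z : Normc.normc (g z - fejer_riesz f n.+1 z)
    <= n.+1%:R^-1 * \sum_(k < n.+1) h k z.
  have -> : g z - fejer_riesz f n.+1 z = real_complex R (n.+1%:R^-1) *
      \sum_(k < n.+1) (g z - riesz_sum f k.+1 z).
    rewrite big_split /= sumrN mulrBr; congr (_ - _).
    rewrite sumr_const card_ord -(mulr_natl (g z)) mulrA -(rmorph_nat (real_complex R)).
    by rewrite -rmorphM mulVf ?mul1r// pnatr_eq0.
  rewrite Normc.normcM; apply: ler_pM; rewrite ?normc_ge0//.
    by rewrite /= expr0n addr0 sqrtr_sqr ger0_norm.
  elim/big_ind2 : _ => [|x1 x2 y1 y2 lx ly|//]; first by rewrite Normc.normc0.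
  by rewrite (le_trans (le_normcD _ _))// lerD.
have isum : sigma.-integrable setT (EFin \o (fun z => \sum_(k < n.+1) h k z)).
  have : sigma.-integrable setT (fun z => \sum_(k < n.+1) (h k z)%:E)%E.
    by apply: integrable_sum => // k _; exact: ih.
  by congr (integrable _ _ _); apply/funext => z; rewrite /= sumEFin.
have isumM : sigma.-integrable setT
    (EFin \o (fun z => n.+1%:R^-1 * \sum_(k < n.+1) h k z)).
  exact: (integrableZl measurableT (n.+1%:R^-1) isum).
have iL : sigma.-integrable setT
    (EFin \o (fun z => Normc.normc (g z - fejer_riesz f n.+1 z))).
  apply: (le_integrable _ _ _ isumM) => //.
    apply/measurable_EFinP; apply: measurable_normc.
    by apply: cmeasurableB; [have [] := g2|exact: cmeasurable_fejer_riesz].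
  move=> z _; rewrite /= lee_fin ger0_norm ?normc_ge0//.
  by rewrite (le_trans (le z))// ler_norm.
split=> //.
have -> : arithmetic_mean u n
    = \int[sigma]_z (n.+1%:R^-1 * \sum_(k < n.+1) h k z).
  rewrite RintegralZl// Rintegral_sum; last by move=> k; exact: ih.
  by rewrite /arithmetic_mean /series /= big_mkord.
exact: le_Rintegral.
Qed.

(** On [0, M] the fourth power is Lipschitz with constant 4 M^3. After truncation at M, the L^1
    convergence of the [fejer_riesz] means to g is thus enough to carry their quartic bound over to
    g. *)
Lemma integral_truncated_quartic (M : R) : 0 < M ->
  (\int[sigma]_z (Num.min (Normc.normc (g z)) M ^+ 4)%:E <= 1)%E.
Proof.
move=> M0; have [mg _] := g2.
have mT : measurable_fun setT (fun z => Num.min (Normc.normc (g z)) M ^+ 4).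
  apply: (measurable_funX 4); apply: measurable_minr; first exact: measurable_normc.
  exact: measurable_cst.
have Tge0 z : 0 <= Num.min (Normc.normc (g z)) M.
  by rewrite le_min normc_ge0 ltW.
have iT : sigma.-integrable setT
    (EFin \o (fun z => Num.min (Normc.normc (g z)) M ^+ 4)).
  apply: (@ae_bounded_integrable _ _ _ _ _ (M ^+ 4)) => //.
  apply: nearW => z; rewrite ger0_norm ?exprn_ge0// lerXn2r ?nnegrE ?(ltW M0)//.
  by rewrite ge_min lexx orbT.
rewrite -[leLHS]fineK ?integrable_fin_num// lee_fin.
apply/ler_addgt0Pr => e e0.
have Mge0 := ltW M0.
(* The Cesaro means of [u] tend to 0 with [u]; the tolerance is chosen to cancel the Lipschitz
   constant. *)
have /cvgrPdist_le/(_ (e / (4 * M ^+ 3)))[|n _ /(_ n (leqnn n))] := cesaro u_cvg0.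
  by rewrite divr_gt0// mulr_gt0// exprn_gt0.
rewrite sub0r normrN => /(le_trans (ler_norm _)) an.
have [le_an iL] := Rintegral_fejer_riesz n.
have q1 := integral_quartic_fejer_riesz (ltn0Sn n) mf f1.
have iq : sigma.-integrable setT (EFin \o (fun z => normsq (fejer_riesz f n.+1 z) ^+ 2)).
  apply/integrableP; split.
    apply/measurable_EFinP; apply: (measurable_funX 2); apply: measurable_normsq.
    exact: cmeasurable_fejer_riesz.
  under eq_integral do rewrite /= ger0_norm ?sqr_ge0//.
  exact: le_lt_trans q1 (ltry _).
have iLM : sigma.-integrable setT
    (EFin \o (fun z => 4 * M ^+ 3 * Normc.normc (g z - fejer_riesz f n.+1 z))).
  exact: (integrableZl measurableT (4 * M ^+ 3) iL).
apply: (@le_trans _ _ (\int[sigma]_z (normsq (fejer_riesz f n.+1 z) ^+ 2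
    + 4 * M ^+ 3 * Normc.normc (g z - fejer_riesz f n.+1 z)))).
  apply: le_Rintegral => //.
    exact: (integrableD measurableT iq iLM).
  move=> z _; set t := Num.min _ _; set v := fejer_riesz f n.+1 z.
  have t0 : 0 <= t by exact: Tge0.
  have tM : t <= M by rewrite /t ge_min lexx orbT.
  have tg : t <= Normc.normc v + Normc.normc (g z - v).
    by rewrite /t ge_min -{1}[g z](subrK v) addrC le_normcD.
  rewrite -sqr_normc -exprM.
  have v0 := normc_ge0 v; have w0 := normc_ge0 (g z - v).
  (* If t <= |v| then t^4 <= |v|^4 already. Otherwise t^4 - |v|^4 <= 4 t^3 (t - |v|), where t <= M
     and t - |v| <= |g - v|. *)
  have [tv|vt] := leP t (Normc.normc v).
    rewrite ler_wpDr ?mulr_ge0 ?exprn_ge0//.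
    by rewrite lerXn2r.
  set a := Normc.normc v in tg v0 vt *.
  have : t ^+ 4 - a ^+ 4 <= 4 * t ^+ 3 * (t - a).
    have -> : t ^+ 4 - a ^+ 4 = (t ^+ 3 + t ^+ 2 * a + t * a ^+ 2 + a ^+ 3) * (t - a) by ring.
    apply: ler_wpM2r; first by rewrite subr_ge0 ltW.
    have -> : 4 * t ^+ 3 = t ^+ 3 + t ^+ 2 * t + t * t ^+ 2 + t ^+ 3 by ring.
    have at_ := ltW vt.
    by rewrite !lerD// ?ler_wpM2l ?exprn_ge0// lerXn2r.
  have : 4 * t ^+ 3 * (t - a) <= 4 * M ^+ 3 * Normc.normc (g z - v).
    apply: ler_pM; rewrite ?mulr_ge0 ?exprn_ge0// ?subr_ge0 ?(ltW vt)//.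
      by rewrite ler_wpM2l// lerXn2r.
    by rewrite lerBlDl.
  by move=> ? ?; lra.
rewrite RintegralD// RintegralZl//; apply: lerD.
  by rewrite -lee_fin fineK// integrable_fin_num.
rewrite -ler_pdivlMl ?mulr_gt0 ?exprn_gt0// mulrC.
exact: le_trans le_an an.
Qed.

(** Monotone convergence as the truncation level runs through the integers; at each z the truncated
    values are constant once the level passes |g z|. *)
Lemma cLnorm4_riesz_limit : (cLnorm sigma 4%:E g <= 1)%E.
Proof.
apply: cLnorm_le1 => //; have [mg _] := g2.
have mT n : measurable_fun setT
    (fun z => (Num.min (Normc.normc (g z)) n%:R ^+ 4)%:E).
  apply/measurable_EFinP.
  apply: (measurable_funX 4); apply: measurable_minr; first exact: measurable_normc.
  exact: measurable_cst.
have T0 n z : 0 <= Num.min (Normc.normc (g z)) n%:R by rewrite le_min normc_ge0 ler0n.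
have ndT z : nondecreasing_seq (fun n => (Num.min (Normc.normc (g z)) n%:R ^+ 4)%:E).
  move=> m n mn; rewrite lee_fin lerXn2r ?nnegrE//.
  by rewrite le_min !ge_min lexx ler_nat mn orbT.
have limT z : limn (fun n => (Num.min (Normc.normc (g z)) n%:R ^+ 4)%:E)
    = (Normc.normc (g z) `^ 4)%:E.
  apply/cvg_lim => //; apply: cvg_near_cst; near=> n.
  rewrite min_l; last by near: n; exact: nbhs_infty_ger.
  by rewrite powR_mulrn ?normc_ge0.
under eq_integral do rewrite -limT.
rewrite monotone_convergence//; last first.
  by move=> n z _; rewrite lee_fin exprn_ge0.
apply: lime_le.
  apply: ereal_nondecreasing_is_cvgn => m n mn; apply: ge0_le_integral => //.
  - by move=> z _; rewrite lee_fin exprn_ge0.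
  - by move=> z _; exact: ndT.
near=> n; apply: integral_truncated_quartic.
by rewrite ltr0n; near: n; exact: nbhs_infty_gt.
Unshelve. all: by end_near. Qed.

End riesz_limit.

(** * The chosen representative of the projection, and the upper bound at exponent 4 *)

Section riesz_proj_theory.
Context {R : realType}.
Local Notation sigma := (sigma1 R).

Lemma cLnorm_cst0 d (T : measurableType d) (mu : probability T R) (p : R) :
  0 < p -> cLnorm mu p%:E (fun=> 0) = 0%E.
Proof.
move=> p0; rewrite cLnormE Normc.normc0 powR0 ?gt_eqF//.
by rewrite integral0 poweR0r// invr_neq0// gt_eqF.
Qed.

Lemma cLnorm_ae_eq d (T : measurableType d) (mu : probability T R) (p : R)
    (f g : T -> R[i]) :
  0 < p -> cmeasurable f -> cmeasurable g -> cLnorm mu 2%:E (fun x => f x - g x) = 0%E ->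
  cLnorm mu p%:E f = cLnorm mu p%:E g.
Proof.
move=> p0 mf mg fg0.
have mfg := cmeasurableB mf mg.
have : (EFin \o (fun x => Normc.normc (f x - g x))) = \0 %[ae mu].
  apply: Lnorm_eq0_eq0 fg0; last by rewrite lte_fin.
  by apply/measurable_EFinP; exact: measurable_normc.
move=> aefg; rewrite !cLnormE; congr poweR.
have mpow (h : T -> R[i]) : cmeasurable h ->
    measurable_fun setT (fun x => (Normc.normc (h x) `^ p)%:E).
  move=> mh; apply/measurable_EFinP.
  exact: (measurableT_comp (measurable_powR _) (measurable_normc mh)).
apply: ae_eq_integral => //; [exact: mpow|exact: mpow|].
apply: filterS aefg => x /(_ I) fgx _; congr (Normc.normc _ `^ p)%:E.
have {}fgx : Normc.normc (f x - g x) = 0 by case: fgx.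
by apply/eqP; rewrite -subr_eq0; apply/eqP/Normc.eq0_normc.
Qed.

Definition is_riesz_proj (f g : circle R -> R[i]) := in_cLp sigma 2%:E g /\
  cLnorm sigma 2%:E (fun z => g z - riesz_sum f n z) @[n --> \oo] --> 0%E.

(** Since the partial sums are eventually g, g is an admissible choice. By uniqueness of limits the
    representative actually chosen lies at L^2 distance 0 from g, so it agrees with g almost
    everywhere and has the same norm for every p. *)
Lemma cLnorm_riesz_proj (p : R) (f g : circle R -> R[i]) n0 : 0 < p ->
  in_cLp sigma 2%:E g -> (forall n, (n0 <= n)%N -> riesz_sum f n = g) ->
  cLnorm sigma p%:E (riesz_proj f) = cLnorm sigma p%:E g.
Proof.
move=> p0 g2 fg.
have near_fg (h : circle R -> R[i]) : \forall n \near \oo,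
    cLnorm sigma 2%:E (fun z => h z - riesz_sum f n z)
    = cLnorm sigma 2%:E (fun z => h z - g z).
  by exists n0 => // n /= /fg ->.
have Pg : is_riesz_proj f g.
  split=> //; apply: cvg_near_cst; apply: filterS (near_fg g) => n ->.
  by under eq_fun do rewrite subrr; rewrite cLnorm_cst0.
have [[mPf _] Pf] : is_riesz_proj f (riesz_proj f).
  exact: xgetPex (ex_intro _ g Pg).
apply: cLnorm_ae_eq => //; first by have [] := g2.
have limg : cLnorm sigma 2%:E (fun z => riesz_proj f z - riesz_sum f n z) @[n --> \oo]
    --> cLnorm sigma 2%:E (fun z => riesz_proj f z - g z).
  by apply: cvg_near_cst; exact: near_fg.
by rewrite -(cvg_lim (@ereal_hausdorff R) limg); exact: cvg_lim Pf.
Qed.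

(** Selects the essential supremum in the norm at [+oo], whose definition branches on the total mass
    being positive. *)
Lemma sigma1_gt0 : (0 < sigma [set: circle R])%E.
Proof. by rewrite [ltRHS]probability_setT. Qed.

Lemma cLnorm_pinfty_le1 (f : circle R -> R[i]) :
  (cLnorm sigma +oo%E f <= 1)%E <-> \forall z \ae sigma, Normc.normc (f z) <= 1.
Proof.
rewrite /cLnorm unlock sigma1_gt0; split.
  move=> /ess_supP; apply: filterS => z.
  by rewrite /= lee_fin ger0_norm// normc_ge0.
move=> f1; apply/ess_supP; apply: filterS f1 => z.
by rewrite /= lee_fin ger0_norm// normc_ge0.
Qed.

Lemma riesz_norm4_le1 : (riesz_norm (4%:E : \bar R) <= 1)%E.
Proof.
apply: ge_ereal_sup => _ [f [[mf _] /cLnorm_pinfty_le1 f1] <-].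
have [Pf|nPf] := pselect (exists g, is_riesz_proj f g).
  have [g2 fg] := xgetPex (fun=> 0) Pf.
  exact: cLnorm4_riesz_limit mf f1 g2 fg.
(* With no admissible g, [riesz_proj f] is the default 0, whose norm is 0. *)
rewrite /riesz_proj xgetPN ?cLnorm_cst0// => g Pg.
by apply: nPf; exists g.
Qed.

End riesz_proj_theory.

(** * The test function and a lower bound for the moments of its projection *)

Section test_function.
Context {R : realType}.
Local Notation sigma := (sigma1 R).
Local Notation "x %:C" := (real_complex R x).

(* A second-order refinement of the tangent inequality for x |-> x^s at 1, with
   x = t^4; it comes from exp y >= 1 + y at y = 4(s-1) ln t and y = -2 ln t. *)
Lemma powR4_ge (s t : R) : 1 <= s -> 0 <= t ->
  1 + s * (t ^+ 4 - 1) + (s - 1) * (t ^+ 2 - 1) ^+ 2 <= t `^ (4 * s).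
Proof.
move=> s1; rewrite le_eqVlt => /predU1P[<-|t0].
  rewrite powR0; last by rewrite mulf_neq0// gt_eqF//; lra.
  by rewrite !expr0n /=; lra.
have -> : 4 * s = 4%:R + 4 * (s - 1) by ring.
rewrite powRD; last by rewrite (gt_eqF t0) implybT.
rewrite powR_mulrn ?(ltW t0)//.
have t2 : 0 < t ^+ 2 by rewrite exprn_gt0.
have lnt : t ^+ 2 - 1 <= 2 * t ^+ 2 * ln t.
  have : 1 + - (2 * ln t) <= expR (- (2 * ln t)) by exact: expR_ge1Dx.
  rewrite expRN mulr_natl -lnXn// lnK ?posrE// => le.
  have := ler_wpM2l (ltW t2) le; rewrite mulfV ?gt_eqF// lnXn// -mulr_natl.
  by lra.
have pw : 1 + 4 * (s - 1) * ln t <= t `^ (4 * (s - 1)).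
  by rewrite /powR gt_eqF// expR_ge1Dx.
apply: le_trans (ler_wpM2l (exprn_ge0 4 (ltW t0)) pw).
(* Scaling [lnt] by 2 (s - 1) t^2 suffices, because t^4 + 2 (s - 1) t^2 (t^2 - 1) equals the
   left-hand side of the goal. *)
have s0 : 0 <= 2 * (s - 1) * t ^+ 2 by rewrite mulr_ge0 ?(ltW t2)//; lra.
have := ler_wpM2l s0 lnt.
have -> : t ^+ 4 = t ^+ 2 * t ^+ 2 by rewrite -exprD.
by move: (t ^+ 2) (ln t) => a b; nra.
Qed.

Variable e : R.
Hypothesis e01 : 0 <= e <= 1.

Let c : R := (Num.sqrt (1 + 12 * e ^+ 3))^-1.
Let D : R := 1 + 12 * e ^+ 3.

Let D_ge1 : 1 <= D.
Proof. by rewrite /D lerDl mulr_ge0// exprn_ge0//; case/andP: e01. Qed.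

Let sqr_c : c ^+ 2 = D^-1.
Proof. by rewrite /c exprVn sqr_sqrtr//; have := D_ge1; rewrite /D; lra. Qed.

(** The zero exponents are kept so that every term has the shape integrated by
    [cintegral_moment]. *)
Definition ftest (z : circle R) : R[i] :=
  (c * (1 - e ^+ 2))%:C * ((z : R[i]) ^+ 0 * conjc (z : R[i]) ^+ 0) +
  (c * e)%:C * ((z : R[i]) ^+ 1 * conjc (z : R[i]) ^+ 0) +
  (- (c * e))%:C * ((z : R[i]) ^+ 0 * conjc (z : R[i]) ^+ 1) +
  (c * e ^+ 2)%:C * ((z : R[i]) ^+ 0 * conjc (z : R[i]) ^+ 2).

Definition gtest (z : circle R) : R[i] :=
  (c * (1 - e ^+ 2))%:C + (c * e)%:C * (z : R[i]).

Let bzz m n : ess_bounded sigma (fun z : circle R => (z : R[i]) ^+ m * conjc (z : R[i]) ^+ n).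
Proof.
have bz := ess_bounded_circle (R := R).
by apply: ess_boundedM; apply: ess_boundedX => //; exact: ess_bounded_conjc.
Qed.

Let bczz (a : R[i]) m n :
  ess_bounded sigma (fun z : circle R => a * ((z : R[i]) ^+ m * conjc (z : R[i]) ^+ n)).
Proof. by apply: ess_boundedM => //; exact: ess_bounded_cst. Qed.

Lemma ftest_ess_bounded : ess_bounded sigma ftest.
Proof.
by apply: ess_boundedD => //; apply: ess_boundedD => //; exact: ess_boundedD.
Qed.

Lemma gtest_ess_bounded : ess_bounded sigma gtest.
Proof.
apply: ess_boundedD; first exact: ess_bounded_cst.
by apply: ess_boundedM; [exact: ess_bounded_cst|exact: ess_bounded_circle].
Qed.

(** For z = x + iy the terms of order e^2 cancel, leaving |f / c|^2 = 1 + e^3 (4 e y^2 - 8 x y^2).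
    The bracket is at most 12 because e <= 1, y^2 <= 1 and x >= -1, whence the constant in [D]. *)
Lemma ftest_le1 z : Normc.normc (ftest z) <= 1.
Proof.
rewrite normc_le1; have := normsq_circle z; rewrite /normsq.
have -> : complex.Re (ftest z) = c * (1 - e ^+ 2 + e ^+ 2 *
    (complex.Re (z : R[i]) ^+ 2 - complex.Im (z : R[i]) ^+ 2)).
  by rewrite /ftest !expr0 !mulr1 !mul1r !expr1 expr2 !ReImE; ring.
have -> : complex.Im (ftest z) = c * (2 * e * complex.Im (z : R[i]) -
    2 * e ^+ 2 * complex.Re (z : R[i]) * complex.Im (z : R[i])).
  by rewrite /ftest !expr0 !mulr1 !mul1r !expr1 expr2 !ReImE; ring.
move: (complex.Re _) (complex.Im _) => x y xy.
rewrite !exprMn sqr_c -mulrDr ler_pdivrMl ?mulr1; last by have := D_ge1; lra.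
have -> : (1 - e ^+ 2 + e ^+ 2 * (x ^+ 2 - y ^+ 2)) ^+ 2 +
    (2 * e * y - 2 * e ^+ 2 * x * y) ^+ 2
  = 1 + e ^+ 3 * (4 * (e * y ^+ 2) - 8 * (y ^+ 2 * x)).
  have -> : x ^+ 2 = 1 - y ^+ 2 by rewrite -xy addrK.
  transitivity ((1 - 2 * e ^+ 2 * y ^+ 2) ^+ 2 + 4 * e ^+ 2 * y ^+ 2
    * (1 - 2 * e * x + e ^+ 2 * x ^+ 2)); first by ring.
  have -> : x ^+ 2 = 1 - y ^+ 2 by rewrite -xy addrK.
  by ring.
have /andP[e0 e1] := e01.
rewrite /D lerD2l mulrC ler_wpM2r ?exprn_ge0//.
have y1 : y ^+ 2 <= 1 by have := sqr_ge0 x; lra.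
have x1 : - 1 <= x <= 1.
  by have x2 : x ^+ 2 <= 1; [have := sqr_ge0 y; lra|apply/andP; split; nra].
have /andP[xl xr] := x1; have := sqr_ge0 y; move: (y ^+ 2) y1 => w w1 w0.
by nra.
Qed.

Lemma fourier_coef_ftest (k : nat) : fourier_coef ftest k%:Z =
  (c * (1 - e ^+ 2))%:C * (0 == k)%N%:R + (c * e)%:C * (1 == k)%N%:R.
Proof.
pose m (a : R[i]) i j (z : circle R) := a * ((z : R[i]) ^+ i * conjc (z : R[i]) ^+ j).
(* Multiplication by conj(z)^k gives the two antianalytic terms the exponents (0, k + 1) and (0, k +
   2), which are never diagonal, so their moments vanish. *)
rewrite /fourier_coef (_ : (fun _ => _) = (fun z =>
    m (c * (1 - e ^+ 2))%:C 0%N k z + m (c * e)%:C 1%N k z +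
    m (- (c * e))%:C 0%N k.+1 z + m (c * e ^+ 2)%:C 0%N k.+2 z)); last first.
  apply/funext => z; rewrite -exprnP rmorphXn /= /ftest /m !expr0 expr1 !exprS.
  by ring.
have mE a i j : cintegral sigma (m a i j) = a * (i == j)%N%:R.
  by rewrite /m cintegralZ ?cintegral_moment//; exact: bzz.
rewrite !cintegralD; try by do ?[exact: bczz | apply: ess_boundedD].
by rewrite ![cintegral _ _]mE /= !mulr0 !addr0.
Qed.

Lemma riesz_sum_ftest n : (2 <= n)%N -> riesz_sum ftest n = gtest.
Proof.
case: n => [|[|n]]// _; apply/funext => z; rewrite /riesz_sum.
rewrite big_ltn// big_ltn// big_nat big1 ?addr0 => [|k /andP[k2 _]].
  by rewrite !fourier_coef_ftest /= !mulr0 !mulr1 addr0 add0r expr1.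
by rewrite fourier_coef_ftest; case: k k2 => [|[|k]]//= _; rewrite !mulr0 addr0 mul0r.
Qed.

Lemma gtest_in_cL2 : in_cLp sigma 2%:E gtest.
Proof.
have [mg [M gM]] := gtest_ess_bounded; split=> //.
rewrite cLnormE poweR_lty//.
have : sigma.-integrable setT (EFin \o (fun z => Normc.normc (gtest z) `^ 2)).
  apply: (@ae_bounded_integrable _ _ _ _ _ (M ^+ 2)).
    exact: (measurableT_comp (measurable_powR _) (measurable_normc mg)).
  apply: filterS gM => z zM; rewrite powR_mulrn ?normc_ge0//.
  rewrite ger0_norm ?exprn_ge0 ?normc_ge0// lerXn2r ?nnegrE ?normc_ge0//.
  exact: le_trans (normc_ge0 _) zM.
by move=> /integrableP[_]; under eq_integral do rewrite /= ger0_norm ?powR_ge0//.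
Qed.

Lemma cLnorm_gtest_le_riesz_norm (p : R) : 0 < p ->
  (cLnorm sigma p%:E gtest <= riesz_norm p%:E)%E.
Proof.
move=> p0; rewrite -(cLnorm_riesz_proj p0 gtest_in_cL2 riesz_sum_ftest).
apply: ereal_sup_ubound; exists ftest => //.
have f1 : (cLnorm sigma +oo%E ftest <= 1)%E.
  by apply/cLnorm_pinfty_le1; apply: nearW; exact: ftest_le1.
by split=> //; split; [have [] := ftest_ess_bounded|exact: le_lt_trans f1 (ltry _)].
Qed.

(** [A] and [B] are the mean and the variance of |1 - e^2 + e z|^2 over the circle. *)
Let A := (1 - e ^+ 2) ^+ 2 + e ^+ 2.
Let B := 2 * (1 - e ^+ 2) ^+ 2 * e ^+ 2.

(** Apply [powR4_ge] at t = |gtest z| and integrate. Since |gtest z|^2 is affine in Re z, the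
    minorant is quadratic in Re z, hence the real part of a polynomial in z whose constant term is
    the asserted bound. *)
Lemma integral_powR_gtest_ge (s : R) : 1 <= s ->
  ((1 + s * (D^-1 ^+ 2 * (A ^+ 2 + B) - 1) +
    (s - 1) * ((D^-1 * A - 1) ^+ 2 + D^-1 ^+ 2 * B))%:E <=
   \int[sigma]_z (Normc.normc (gtest z) `^ (4 * s))%:E)%E.
Proof.
move=> s1; set al := (X in X%:E); set m := D^-1.
pose b := 2 * m * (1 - e ^+ 2) * e.
(* [be] collects the terms linear in x = Re z. The quadratic coefficient (2 s - 1) b^2 is halved in
   [ga] because x^2 = (1 + Re (z^2)) / 2 on the circle; the other half enters the constant term. *)
pose be := s * (2 * m * A * b) + (s - 1) * (2 * (m * A - 1) * b).
pose ga := (2 * s - 1) * b ^+ 2 / 2.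
pose P : {poly R[i]} := al%:C%:P + be%:C *: 'X + ga%:C *: 'X^2.
have PE (z : R[i]) : P.[z] = al%:C + be%:C * z + ga%:C * z ^+ 2.
  by rewrite /P !(hornerD, hornerZ, hornerC, hornerX, hornerXn).
have [iP _] := ess_bounded_integrable (ess_bounded_horner P).
have -> : al%:E = (\int[sigma]_z (complex.Re P.[z : R[i]])%:E)%E.
  rewrite -[RHS]fineK ?integrable_fin_num// -[fine _]/(Rintegral _ _ _) -ReintE.
  by rewrite cintegral_horner -horner_coef0 PE !mulr0 addr0 expr0n mulr0 addr0.
have [mg [M gM]] := gtest_ess_bounded.
apply: le_integral => //.
  apply: (@ae_bounded_integrable _ _ _ _ _ (M `^ (4 * s))).
    exact: (measurableT_comp (measurable_powR _) (measurable_normc mg)).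
  apply: filterS gM => z zM; rewrite ger0_norm ?powR_ge0//.
  apply: ge0_ler_powR; rewrite ?nnegrE ?normc_ge0//; first by lra.
  exact: le_trans (normc_ge0 _) zM.
move=> z _; rewrite lee_fin (le_trans _ (powR4_ge s1 (normc_ge0 _)))//.
rewrite -[4%N]/(2 * 2)%N exprM sqr_normc.
have z1 := normsq_circle z; rewrite /normsq in z1.
have -> : normsq (gtest z) = m * A + b * complex.Re (z : R[i]).
  transitivity (c ^+ 2 * ((1 - e ^+ 2) ^+ 2 + 2 * (1 - e ^+ 2) * e * complex.Re (z : R[i])
      + e ^+ 2 * normsq (z : R[i]))).
    by rewrite /normsq /gtest !ReImE; ring.
  by rewrite normsq_circle sqr_c -/m /b /A; ring.
rewrite PE expr2 !ReImE !mul0r !subr0.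
move: z1; move: (complex.Re _) (complex.Im _) => x y xy.
have -> : x * x - y * y = 2 * x ^+ 2 - 1.
  by rewrite -[X in _ = _ - X]xy; ring.
rewrite le_eqVlt; apply/orP; left; apply/eqP.
by rewrite /al -/m /be /ga /B /b; field.
Qed.

End test_function.

(** * Lower bounds for the operator norm, and the critical exponent *)

Lemma cLnorm_ge1 (R : realType) d (T : measurableType d) (mu : probability T R)
    (p : R) (f : T -> R[i]) : 0 < p ->
  (1 <= \int[mu]_x (Normc.normc (f x) `^ p)%:E)%E -> (1 <= cLnorm mu p%:E f)%E.
Proof.
move=> p0 If; rewrite cLnormE -[leLHS](poweR1r p^-1).
have I0 := le_trans (@lee01 R) If.
by rewrite gt0_ler_poweR ?invr_ge0 ?(ltW p0)// in_itv/= ?leey ?andbT ?lee01.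
Qed.

Lemma cLnorm_gt1 (R : realType) d (T : measurableType d) (mu : probability T R)
    (p : R) (f : T -> R[i]) : 0 < p ->
  (1 < \int[mu]_x (Normc.normc (f x) `^ p)%:E)%E -> (1 < cLnorm mu p%:E f)%E.
Proof.
move=> p0; rewrite !ltNge; apply: contra => N1.
have -> : (\int[mu]_x (Normc.normc (f x) `^ p)%:E = cLnorm mu p%:E f `^ p)%E.
  rewrite cLnormE -poweRrM mulVf ?gt_eqF// poweRe1//.
  by apply: integral_ge0 => x _; rewrite lee_fin powR_ge0.
rewrite -[leRHS](poweR1r p) gt0_ler_poweR ?(ltW p0)// in_itv/= leey andbT ?lee01//.
exact: Lnorm_ge0.
Qed.

Lemma riesz_norm4_ge1 (R : realType) : (1 <= riesz_norm (4%:E : \bar R))%E.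
Proof.
(* At e = 0 the test function is the constant 1, and p = 4 corresponds to s = 1. *)
have e01 : 0 <= (0 : R) <= 1 by rewrite lexx ler01.
have p0 : 0 < (4 : R) by [].
apply: le_trans (cLnorm_gtest_le_riesz_norm e01 p0); apply: cLnorm_ge1 => //.
have := integral_powR_gtest_ge e01 (lexx 1); rewrite mulr1; apply: le_trans.
by rewrite lee_fin !expr0n /= !(mulr0, mul0r, addr0, subr0, invr1, expr1n, mulr1, subrr).
Qed.

Lemma riesz_norm_gt1 (R : realType) (p : R) : 4 < p -> (1 < riesz_norm p%:E)%E.
Proof.
move=> p4; pose s : R := p / 4.
have s1 : 1 < s by rewrite /s ltr_pdivlMr// mul1r.
have p0 : 0 < p by lra.
(* The gain from the variance is about 2 (s - 1) e^2 and the loss in the fourth moment about 24 s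
   e^3. With s - 1 = 200 s e both become multiples of s e^3, with factors near 400 and 24. *)
pose e : R := (s - 1) / (200 * s).
have s200 : 0 < 200 * s by lra.
have e0 : 0 < e by rewrite /e divr_gt0//; lra.
have es : 200 * s * e = s - 1 by rewrite /e mulrC divfK// gt_eqF.
move: e e0 es => {}e e0 es.
have e1 : e <= 1 / 200 by nra.
have e01 : 0 <= e <= 1 by rewrite (ltW e0)/=; lra.
apply: lt_le_trans (cLnorm_gtest_le_riesz_norm e01 p0); apply: cLnorm_gt1 => //.
have := integral_powR_gtest_ge e01 (ltW s1).
have -> : 4 * s = p by rewrite /s mulrC divfK.
apply: lt_le_trans; rewrite lte_fin.
set D := 1 + 12 * e ^+ 3; set A := (1 - e ^+ 2) ^+ 2 + e ^+ 2.
set B := 2 * (1 - e ^+ 2) ^+ 2 * e ^+ 2.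
have e30 := exprn_ge0 3 (ltW e0).
have D1 : 1 <= D by rewrite /D; lra.
have D0 : 0 < D by lra.
rewrite -subr_gt0.
have -> : 1 + s * (D^-1 ^+ 2 * (A ^+ 2 + B) - 1)
    + (s - 1) * ((D^-1 * A - 1) ^+ 2 + D^-1 ^+ 2 * B) - 1
  = ((s - 1) * B - s * (D ^+ 2 - (A ^+ 2 + B)) + (s - 1) * (A - D) ^+ 2) / D ^+ 2.
  by field; rewrite gt_eqF.
apply: divr_gt0; last by rewrite exprn_gt0.
(* The term (s - 1) (A - D)^2 is nonnegative and is dropped; what remains is the variance gain minus
   the moment loss. *)
apply: ltr_wpDr; first by rewrite mulr_ge0 ?sqr_ge0//; lra.
have -> : D ^+ 2 - (A ^+ 2 + B)
    = e ^+ 3 * (24 + e + 144 * e ^+ 3 - e ^+ 5) by rewrite /D /A /B; ring.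
rewrite -es /B.
have -> : 200 * s * e * (2 * (1 - e ^+ 2) ^+ 2 * e ^+ 2)
    - s * (e ^+ 3 * (24 + e + 144 * e ^+ 3 - e ^+ 5))
  = s * e ^+ 3 * (400 * (1 - e ^+ 2) ^+ 2 - (24 + e + 144 * e ^+ 3 - e ^+ 5)) by ring.
apply: mulr_gt0; first by apply: mulr_gt0; [lra|exact: exprn_gt0].
(* Crude bounds suffice: 400 (1 - e^2)^2 is at least 200, while the subtracted bracket is below 24 +
   1 + 144. *)
have e3 : e ^+ 3 <= 1 by apply: exprn_ile1; lra.
have e5 : 0 <= e ^+ 5 by rewrite exprn_ge0// ltW.
have e2 : e ^+ 2 <= 1 / 4 by nra.
have : 1 / 2 <= (1 - e ^+ 2) ^+ 2 by move: (e ^+ 2) e2 => w w2; nra.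
by move=> ?; lra.
Qed.

Theorem theorem1 (R : realType) :
  ereal_sup [set p%:E | p in [set p : R | 2 <= p /\ riesz_norm p%:E = 1%E]]
    = 4%:E.
Proof.
apply/eqP; rewrite eq_le; apply/andP; split.
  apply: ge_ereal_sup => _ [p [_ normp] <-]; rewrite lee_fin leNgt.
  by apply/negP => /riesz_norm_gt1; rewrite normp ltxx.
apply: ereal_sup_ubound; exists 4 => //; split; first by lra.
by apply/eqP; rewrite eq_le riesz_norm4_le1 riesz_norm4_ge1.
Qed.
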